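(* $z_{NC}\leq z_{P}\leq z_{C}$, where $z_{NC}$, $z_P$, $z_C$ are the optimal objective values of the non-convex, polyhedral and convex relaxations of the chance-constrained binary knapsack problem, respectively.
   Context: Let $N=\{1,\dots,n\}$ be a set of items. Each $j\in N$ has a profit $c_j>0$, a mean weight $a_j>0$ and a standard deviation $\sigma_j\ge 0$; the capacity is $b>0$; $\rho\in[0.5,1)$; and $\Phi^{-1}$ is the inverse of the standard normal cumulative distribution function. Standing assumptions: $\sum_{j\in N}a_j+\Phi^{-1}(\rho)\sqrt{\sum_{j\in N}\sigma_j^2}>b$, and $a_j+\Phi^{-1}(\rho)\sigma_j\le b$ for each $j\in N$. Non-convex relaxation: $z_{NC}=\max\{\sum_{j\in N}c_jx_j : x\in[0,1]^n,\ g(x)\le b\}$, where $g(x)=\sum_{j\in N}a_jx_j+\Phi^{-1}(\rho)\sqrt{\sum_{j\in N}\sigma_j^2x_j}$. Polyhedral relaxation: for $S\subseteq N$ let $F(S)=\sum_{j\in S}a_j+\Phi^{-1}(\rho)\sqrt{\sum_{j\in S}\sigma_j^2}$, let $\Pi=\{\pi\in\mathbb{R}^n:\sum_{j\in S}\pi_j\le F(S)\ \forall S\subseteq N\}$, and let $\mathrm{ext}(\Pi)$ be the set of extreme points of $\Pi$. Then $z_P=\max\{\sum_{j\in N}c_jx_j: x\in[0,1]^n,\ \sum_{j\in N}\pi_jx_j\le b\ \forall \pi\in\mathrm{ext}(\Pi)\}$. Convex relaxation: $z_C=\max\{\sum_{j\in N}c_jx_j: x\in[0,1]^n,\ \sum_{j\in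 N}a_jx_j+\Phi^{-1}(\rho)\sqrt{\sum_{j\in N}\sigma_j^2x_j^2}\le b\}$. *)

(* Defs.v *)
From HB Require Import structures.
From mathcomp Require Import all_boot all_order all_algebra.
From mathcomp Require Import all_classical all_reals all_analysis.
From mathcomp Require Import measurable_realfun.
Set Implicit Arguments.
Unset Strict Implicit.
Unset Printing Implicit Defensive.
Import Order.TTheory GRing.Theory Num.Theory.
Import numFieldNormedType.Exports.

Local Open Scope classical_set_scope.
Local Open Scope ring_scope.

Definition Phi {R : realType} (x : R) : R := fine (normal_prob 0 1 `]-oo, x]).

(* The default value 0 is only returned outside of the range ]0, 1[ of Phi,
   see Phi_invK below. *)
Definition Phi_inv {R : realType} : R -> R := 'pinv_(fun=> 0) [set: R] Phi.

Definition extreme_points {R : realType} {V : lmodType R} (A : set V) : set V :=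
  [set x | A x /\ forall (y z : V) (t : R), A y -> A z -> 0 < t < 1 ->
     x = t *: y + (1 - t) *: z -> y = x /\ z = x].

Section relaxations.
Context {R : realType} {n : nat}.
Implicit Types (c a sigma : 'I_n -> R) (b rho : R) (x p : 'rV[R]_n).

Definition unit_cube : set 'rV[R]_n := [set x | forall j, 0 <= x ord0 j <= 1].

Definition objective c x : R := \sum_j c j * x ord0 j.

(* For the three feasible sets below and 0 <= b this supremum is an attained
   maximum: see z_NC_max, z_P_max and z_C_max. *)
Definition optimal_value c (X : set 'rV[R]_n) : R :=
  sup [set objective c x | x in X].

Definition feasible_NC a sigma rho b : set 'rV[R]_n :=
  [set x | unit_cube x /\
     \sum_j a j * x ord0 j +
       Phi_inv rho * Num.sqrt (\sum_j sigma j ^+ 2 * x ord0 j) <= b].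

Definition F a sigma rho (S : {set 'I_n}) : R :=
  \sum_(j in S) a j + Phi_inv rho * Num.sqrt (\sum_(j in S) sigma j ^+ 2).

Definition Pi a sigma rho : set 'rV[R]_n :=
  [set p | forall S : {set 'I_n}, \sum_(j in S) p ord0 j <= F a sigma rho S].

Definition feasible_P a sigma rho b : set 'rV[R]_n :=
  [set x | unit_cube x /\
     forall p, extreme_points (Pi a sigma rho) p ->
       \sum_j p ord0 j * x ord0 j <= b].

Definition feasible_C a sigma rho b : set 'rV[R]_n :=
  [set x | unit_cube x /\
     \sum_j a j * x ord0 j +
       Phi_inv rho * Num.sqrt (\sum_j sigma j ^+ 2 * x ord0 j ^+ 2) <= b].

Definition z_NC c a sigma rho b := optimal_value c (feasible_NC a sigma rho b).
Definition z_P c a sigma rho b := optimal_value c (feasible_P a sigma rho b).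
Definition z_C c a sigma rho b := optimal_value c (feasible_C a sigma rho b).

End relaxations.

Lemma Phi_sub {R : realType} (x y : R) : x <= y ->
  (Phi y - Phi x)%:E = normal_prob 0 1 `]x, y].
Proof.
move=> xy; have fin z : normal_prob 0 1 `]-oo, z] \is a @fin_num R.
  by rewrite fin_num_measure.
have -> : Phi y = fine (normal_prob 0 1 `]-oo, x] + normal_prob 0 1 `]x, y])%E.
  rewrite /Phi -measureU//=; last first.
    by apply/seteqP; split=> // z /=; rewrite !in_itv/= ltNge => -[->].
  by rewrite -itv_bndbnd_setU// bnd_simp.
rewrite fineD ?fin// ?fin_num_measure// addrAC subrr add0r fineK//.
by rewrite fin_num_measure.
Qed.

Lemma Phi_mono {R : realType} : {mono @Phi R : x y / x < y}.
Proof.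
apply: leW_mono; apply: le_mono => x y xy.
rewrite -subr_gt0 -lte_fin Phi_sub ?ltW//.
pose k : R := normal_peak 1 * expR (- (x ^+ 2 + y ^+ 2)).
have k0 : 0 < k by rewrite mulr_gt0 ?expR_gt0 ?normal_peak_gt0 ?oner_neq0.
apply: (@lt_le_trans _ _ (\int[lebesgue_measure]_(z in `]x, y]) k%:E)%E).
  rewrite integral_cst//= lebesgue_measure_itv/= lte_fin xy.
  by rewrite -EFinB -EFinM lte_fin mulr_gt0// subr_gt0.
apply: ge0_le_integral => //=.
- by move=> z _; rewrite lee_fin ltW.
- apply/measurable_EFinP; apply: measurable_funTS.
  exact: measurable_normal_pdf.
- move=> z; rewrite in_itv/= => /andP[]; move: z => /= z xz zy.
  rewrite lee_fin normal_pdfE ?oner_neq0// ler_pM2l ?normal_peak_gt0 ?oner_neq0//.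
  have zxy : (z : R) ^+ 2 <= x ^+ 2 + y ^+ 2.
    have [z0|/ltW z0] := leP 0 (z : R).
      rewrite (@le_trans _ _ (y ^+ 2)) ?lerDr ?sqr_ge0// lerXn2r//.
      by rewrite nnegrE (le_trans z0).
    rewrite (@le_trans _ _ (x ^+ 2)) ?lerDl ?sqr_ge0// -sqrrN -(sqrrN x).
    by rewrite lerXn2r ?nnegrE ?oppr_ge0 ?lerN2 ?(le_trans (ltW xz))// ltW.
  rewrite ler_expR subr0 expr1n mulNr lerN2 (le_trans _ zxy)//.
  by rewrite ler_piMr ?sqr_ge0// invf_le1 ?ler1n// ltr0n.
Qed.

Lemma Phi_continuous {R : realType} : continuous (@Phi R).
Proof.
have P0 : 0 < normal_peak (1 : R) by rewrite normal_peak_gt0 ?oner_neq0.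
have lip (x y : R) : x <= y -> `|Phi y - Phi x| <= normal_peak 1 * (y - x).
  move=> xy; have /ger0_norm -> : 0 <= Phi y - Phi x.
    by rewrite -lee_fin Phi_sub.
  rewrite -lee_fin Phi_sub//.
  apply: (@le_trans _ _
    (\int[lebesgue_measure]_(z in `]x, y]) (normal_peak (1 : R))%:E)%E).
    apply: ge0_le_integral => //=.
    - by move=> z _; rewrite lee_fin normal_pdf_ge0.
    - apply/measurable_EFinP; apply: measurable_funTS.
      exact: measurable_normal_pdf.
    - by move=> z _; rewrite lee_fin normal_pdf_ub ?oner_neq0.
  rewrite integral_cst//= lebesgue_measure_itv/= lte_fin.
  case: ltP => xy'; first by rewrite -EFinB -EFinM.
  by rewrite mule0 lee_fin mulr_ge0 ?subr_ge0// ltW.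
move=> x; apply/cvgrPdist_le => e e0; near=> y.
apply: (@le_trans _ _ (normal_peak 1 * `|x - y|)).
  have [xy|/ltW yx] := leP x y.
    by rewrite distrC (distrC x) (le_trans (lip _ _ xy))// ger0_norm ?subr_ge0.
  by rewrite (le_trans (lip _ _ yx))// ger0_norm ?subr_ge0.
rewrite mulrC -ler_pdivlMr//; near: y.
by apply: cvgr_dist_le; [exact: cvg_id|exact: divr_gt0].
Unshelve. all: by end_near. Qed.

Lemma Phi_range {R : realType} : range (@Phi R) = `]0, 1[%classic.
Proof.
pose P : probability (measurableTypeR R) R := normal_prob (0 : R) 1.
pose idTR : measurableTypeR R -> R := idfun.
pose mid := isMeasurableFun.Build _ _ _ _ idTR (@measurable_id _ _ setT).
pose X : {RV P >-> R} := HB.pack idTR mid.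
have PE : Phi = fine \o cdf X by [].
have cvg1 : Phi x @[x --> +oo] --> (1 : R).
  by rewrite PE; exact/fine_cvg/cvg_cdfy1.
have cvg0 : Phi x @[x --> -oo] --> (0 : R).
  by rewrite PE; exact/fine_cvg/cvg_cdfNy0.
have bnd (x : R) : 0 <= Phi x <= 1.
  have fin : cdf X x \is a fin_num by rewrite fin_num_measure.
  by rewrite PE /comp fine_ge0 ?cdf_ge0// -lee_fin fineK// cdf_le1.
apply/seteqP; split=> [_ [x _ <-]|r]/=; rewrite in_itv/=.
  have /andP[h0 _] := bnd (x - 1); have /andP[_ h1] := bnd (x + 1).
  apply/andP; split.
    by rewrite (le_lt_trans h0)// Phi_mono ltrBlDr ltrDl.
  by rewrite (lt_le_trans _ h1)// Phi_mono ltrDl.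
move=> /andP[r0 r1].
have [u ru] : exists u, r < Phi u.
  by apply: (@filter_ex _ (+oo : set_system R)); exact: (cvgr_gt _ cvg1).
have [l lr] : exists l, Phi l < r.
  by apply: (@filter_ex _ (-oo : set_system R)); exact: (cvgr_lt _ cvg0).
have lu : l <= u by rewrite ltW// -Phi_mono (lt_trans lr).
have [||x _ xr] := @IVT R Phi l u r lu.
- exact/continuous_subspaceT/Phi_continuous.
- by rewrite ge_min le_max (ltW lr) (ltW ru) orbT.
by exists x.
Qed.

Lemma Phi_invK {R : realType} (r : R) : 0 < r < 1 -> Phi (Phi_inv r) = r.
Proof. by move=> r01; apply: pinvK; rewrite inE Phi_range/= in_itv. Qed.

Section attainment.
Context {R : realType} {n : nat}.
Implicit Types (c a sigma : 'I_n -> R) (b rho : R) (x p : 'rV[R]_n).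

Let linear_form_continuous (f : 'I_n -> R) :
  continuous (fun x => \sum_j f j * x ord0 j).
Proof.
apply: continuous_big => [|j _ x]; first exact: add_continuous.
apply: (@continuousM R _ (cst (f j)) (fun x : 'rV[R]_n => x ord0 j) x).
  exact: cst_continuous.
exact: coord_continuous.
Qed.

Let sum_sqr_continuous (f : 'I_n -> R) :
  continuous (fun x => \sum_j f j * x ord0 j ^+ 2).
Proof.
apply: continuous_big => [|j _ x]; first exact: add_continuous.
apply: (@continuousM R _ (cst (f j)) (fun x : 'rV[R]_n => x ord0 j ^+ 2) x).
  exact: cst_continuous.
apply: (@continuous_comp _ _ _ (fun x : 'rV[R]_n => x ord0 j)
                               (fun r : R => r ^+ 2) x).
  exact: coord_continuous.
exact: sqr_continuous.
Qed.

Let add_sqrt_continuous (f g : 'rV[R]_n -> R) (z : R) :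
  continuous f -> continuous g -> continuous (fun x => f x + z * Num.sqrt (g x)).
Proof.
move=> cf cg x.
apply: (@continuousD _ _ _ f (fun x => z * Num.sqrt (g x)) x); first exact: cf.
apply: (@continuousM _ _ (cst z) (fun x => Num.sqrt (g x)) x).
  exact: cst_continuous.
apply: (@continuous_comp _ _ _ g Num.sqrt x); first exact: cg.
exact: sqrt_continuous.
Qed.

Let closed_sublevel (f : 'rV[R]_n -> R) b :
  continuous f -> closed [set x | f x <= b].
Proof. by move=> cf; apply: (preimage_closed _ (@closed_le _ b)) => x _; exact: cf. Qed.

Let closed_cap (T : Type) (G : T -> set 'rV[R]_n) (D : set T) :
  (forall i, D i -> closed (G i)) -> closed [set x | forall i, D i -> G i x].
Proof. exact: closed_bigI. Qed.

Lemma unit_cube_compact : compact (@unit_cube R n).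
Proof.
have := @rV_compact R n (fun=> `[0, 1]%classic) (fun=> @segment_compact R 0 1).
by congr compact; apply/seteqP; split=> x /= h i; have := h i; rewrite in_itv.
Qed.

Lemma optimal_value_max c (X : set 'rV[R]_n) :
  X `<=` unit_cube -> closed X -> X !=set0 ->
  exists2 x, X x &
    objective c x = optimal_value c X /\
    forall y, X y -> objective c y <= objective c x.
Proof.
move=> XI Xcl X0.
have Xc : compact X := subclosed_compact Xcl unit_cube_compact XI.
have [|x xX xmax] := @EVT_max_rV R n (objective c) X X0 Xc.
  exact/continuous_subspaceT/linear_form_continuous.
move: xX; rewrite inE => xX; exists x => //.
have ub y : X y -> objective c y <= objective c x.
  by move=> yX; apply: xmax; rewrite inE.
split=> //; apply/eqP; rewrite eq_le; apply/andP; split.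
  apply: ub_le_sup; last by exists x.
  by exists (objective c x) => _ [y yX <-]; exact: ub.
apply: ge_sup; first by exists (objective c x), x.
by move=> _ [y yX <-]; exact: ub.
Qed.

Lemma unit_cube0 : @unit_cube R n 0.
Proof. by move=> j; rewrite mxE lexx ler01. Qed.

Let sum0 (f : 'I_n -> R) : \sum_j f j * (0 : 'rV[R]_n) ord0 j = 0.
Proof. by apply: big1 => j _; rewrite mxE mulr0. Qed.

Let closed_cube : closed (@unit_cube R n).
Proof.
apply: (compact_closed _ unit_cube_compact).
exact: norm_hausdorff.
Qed.

Lemma z_NC_max c a sigma rho b : 0 <= b ->
  exists2 x, feasible_NC a sigma rho b x &
    objective c x = z_NC c a sigma rho b /\
    forall y, feasible_NC a sigma rho b y -> objective c y <= objective c x.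
Proof.
move=> b0; apply: optimal_value_max; first by move=> x [].
  apply: closedI => //; apply: closed_sublevel.
  by apply: add_sqrt_continuous; exact: linear_form_continuous.
by exists 0; split; [exact: unit_cube0|rewrite !sum0 sqrtr0 mulr0 addr0].
Qed.

Lemma z_P_max c a sigma rho b : 0 <= b ->
  exists2 x, feasible_P a sigma rho b x &
    objective c x = z_P c a sigma rho b /\
    forall y, feasible_P a sigma rho b y -> objective c y <= objective c x.
Proof.
move=> b0; apply: optimal_value_max; first by move=> x [].
  apply: closedI => //; apply: closed_cap => p _; apply: closed_sublevel.
  exact: linear_form_continuous.
by exists 0; split=> [|p _]; [exact: unit_cube0|rewrite sum0].
Qed.

Lemma z_C_max c a sigma rho b : 0 <= b ->
  exists2 x, feasible_C a sigma rho b x &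
    objective c x = z_C c a sigma rho b /\
    forall y, feasible_C a sigma rho b y -> objective c y <= objective c x.
Proof.
move=> b0; apply: optimal_value_max; first by move=> x [].
  apply: closedI => //; apply: closed_sublevel.
  apply: add_sqrt_continuous; first exact: linear_form_continuous.
  exact: sum_sqr_continuous.
exists 0; split; first exact: unit_cube0.
rewrite sum0 big1 ?sqrtr0 ?mulr0 ?addr0// => j _.
by rewrite mxE expr0n/= mulr0.
Qed.

End attainment.

(* Main.v *)
Require Import Defs.
From mathcomp Require Import all_boot all_order all_algebra.
From mathcomp Require Import all_classical all_reals all_analysis.
From mathcomp Require Import measurable_realfun ring lra.
Import Order.TTheory GRing.Theory Num.Theory.
Local Open Scope ring_scope.

(** Both inequalities come from inclusions of feasible sets. Put z = Phi_inv rho.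
    As rho >= 1/2, z >= 0 ([Phi_inv_ge0]): the square root terms count positively,
    which makes g concave, F submodular and the left-hand side of the convex
    constraint sublinear.

    From the non-convex to the polyhedral set ([feasible_NC_P]): for p in Pi, the
    function h(y) = g(y) - p.y is concave on the unit cube, because the argument
    of the square root in g is linear in y. On the indicator vector of S it
    equals F(S) - p(S) >= 0, and a concave function on a cube which is nonnegative
    at the vertices is nonnegative ([concave_unit_cube_ge0]). Hence g(x) <= b
    implies p.x <= b for all p in Pi, extreme or not.

    From the polyhedral to the convex set ([feasible_P_C]): given x, Edmonds'
    greedy algorithm, run along the items sorted by decreasing x_j, produces a
    point p of Pi which makes the constraints of all the initial segments tight
    ([greedy_point], by submodularity); being determined by these tight
    constraints, p is extreme ([tight_along_extreme]). Write x as a nonnegative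
    combination of the indicators of the initial segments. The left-hand side of
    the convex constraint is sublinear (Minkowski) and takes the value F(S) on
    the indicator of S, so its value at x is at most the same combination of the
    F(S), which is p.x ([sublinear_le_tight]). In other words, p.x is the Lovasz
    extension of F at x, and it dominates every sublinear function which agrees
    with F on indicators. *)

(** * Sign of the normal quantile *)

(** The half-lines ]-oo, x] and [0, +oo[ are disjoint, and by symmetry of the
    density the second one has mass Phi 0 > Phi x; so 2 Phi x < 1. *)
Lemma Phi_lt_half {R : realType} (x : R) : x < 0 -> Phi x < 2^-1.
Proof.
move=> x0; pose P : probability (measurableTypeR R) R := normal_prob (0 : R) 1.
have fin (A : set (measurableTypeR R)) : measurable A -> P A \is a fin_num.
  by move=> mA; rewrite fin_num_measure.
have sym : P `[0, +oo[%classic = P `]-oo, 0]%classic.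
  rewrite /P /= /normal_prob ge0_integration_by_substitution0.
  - apply: eq_integral => r _; congr EFin.
    by rewrite !normal_pdfE ?oner_neq0// /normal_fun !subr0 sqrrN.
  - by apply/measurable_EFinP; exact: measurable_normal_pdf.
  - by move=> r; rewrite lee_fin normal_pdf_ge0.
have : (P (`]-oo, x]%classic : set R) + P (`[0%R, +oo[%classic : set R) <= 1)%E.
  rewrite -measureU//=; first by apply: probability_le1; exact: measurableU.
  apply/seteqP; split=> // z /=; rewrite !in_itv/= andbT => -[zx z0].
  by have := le_lt_trans z0 (le_lt_trans zx x0); rewrite ltxx.
have := Phi_mono x 0; rewrite x0 sym /Phi -/P => lt0.
rewrite -(fineK (fin _ _)) // -[X in (_ + X)%E](fineK (fin _ _)) // -EFinD lee_fin.
by lra.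
Qed.

Lemma Phi_inv_ge0 {R : realType} (rho : R) :
  2^-1 <= rho < 1 -> 0 <= Phi_inv rho.
Proof.
move=> /andP[rho2 rho1]; rewrite leNgt; apply/negP => /Phi_lt_half.
by rewrite Phi_invK ?rho1 ?andbT; lra.
Qed.

(** * Inequalities for square roots *)

Section sqrt.
Context {R : realType}.
Implicit Types u v w t : R.

Lemma sqrt_concave u v t : 0 <= u -> 0 <= v -> 0 <= t <= 1 ->
  t * Num.sqrt u + (1 - t) * Num.sqrt v <= Num.sqrt (t * u + (1 - t) * v).
Proof.
move=> u0 v0 /andP[t0 t1].
have t10 : 0 <= 1 - t by rewrite subr_ge0.
rewrite -[leLHS]ger0_norm ?addr_ge0 ?mulr_ge0 ?sqrtr_ge0// -sqrtr_sqr.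
apply: ler_wsqrtr; rewrite -{2}(sqr_sqrtr u0) -{2}(sqr_sqrtr v0) -subr_ge0.
set p := Num.sqrt u; set q := Num.sqrt v.
rewrite (_ : _ - _ = t * (1 - t) * (p - q) ^+ 2); last by ring.
by apply: mulr_ge0; [exact: mulr_ge0|exact: sqr_ge0].
Qed.

(** The one-variable form of the submodularity of S |-> sqrt (sum of the variances
    over S): after squaring, it amounts to (w + v) u <= (w + u) v. *)
Lemma sqrt_decreasing_increments u v w : 0 <= u <= v -> 0 <= w ->
  Num.sqrt (w + v) + Num.sqrt u <= Num.sqrt (w + u) + Num.sqrt v.
Proof.
move=> /andP[u0 uv] w0; have v0 := le_trans u0 uv.
rewrite -(@ler_pXn2r _ 2) ?nnegrE ?addr_ge0 ?sqrtr_ge0//.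
rewrite !sqrrD !sqr_sqrtr ?addr_ge0// -!sqrtrM ?addr_ge0//.
suff : Num.sqrt ((w + v) * u) <= Num.sqrt ((w + u) * v) by lra.
by apply: ler_wsqrtr; nra.
Qed.

(** Triangle inequality in the Euclidean plane, from Lagrange's identity; it is the
    inductive step of Minkowski's inequality for sums of any length. *)
Lemma sqrt_sqrD_subadditive u v w t :
  Num.sqrt ((u + v) ^+ 2 + (w + t) ^+ 2) <=
    Num.sqrt (u ^+ 2 + w ^+ 2) + Num.sqrt (v ^+ 2 + t ^+ 2).
Proof.
rewrite -(@ler_pXn2r _ 2) ?nnegrE ?addr_ge0 ?sqrtr_ge0//.
rewrite [leRHS]sqrrD !sqr_sqrtr ?addr_ge0 ?sqr_ge0// -sqrtrM ?addr_ge0 ?sqr_ge0//.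
suff : u * v + w * t <= Num.sqrt ((u ^+ 2 + w ^+ 2) * (v ^+ 2 + t ^+ 2)) by nra.
rewrite (le_trans (ler_norm _))// -sqrtr_sqr ler_wsqrtr// -subr_ge0.
rewrite (_ : _ - _ = (u * t - w * v) ^+ 2) ?sqr_ge0//; ring.
Qed.

Lemma minkowski_sum (I : Type) (r : seq I) (f g : I -> R) :
  Num.sqrt (\sum_(i <- r) (f i + g i) ^+ 2) <=
    Num.sqrt (\sum_(i <- r) f i ^+ 2) + Num.sqrt (\sum_(i <- r) g i ^+ 2).
Proof.
have sum_ge0 (h : I -> R) s : 0 <= \sum_(i <- s) h i ^+ 2.
  by apply: sumr_ge0 => i _; exact: sqr_ge0.
elim: r => [|i r IH]; first by rewrite !big_nil sqrtr0 addr0.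
rewrite !big_cons.
set A := \sum_(i <- r) _ in IH *; set B := \sum_(i <- r) f i ^+ 2 in IH *.
set C := \sum_(i <- r) _ in IH *.
have A0 : 0 <= A by exact: sum_ge0.
have B0 : 0 <= B by exact: sum_ge0.
have C0 : 0 <= C by exact: sum_ge0.
rewrite -{1}(sqr_sqrtr B0) -{1}(sqr_sqrtr C0).
apply: le_trans (sqrt_sqrD_subadditive _ _ _ _); apply: ler_wsqrtr.
rewrite lerD2l -{1}(sqr_sqrtr A0) lerXn2r ?nnegrE ?addr_ge0 ?sqrtr_ge0//.
Qed.

End sqrt.

(** * Concave functions on the unit cube *)

Section cube.
Context {R : realType} {n : nat}.
Implicit Types (x y p : 'rV[R]_n) (S A B : {set 'I_n}).

Definition indicator S : 'rV[R]_n := \row_j (j \in S)%:R.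

Lemma sum_indicator (f : 'I_n -> R) S :
  \sum_j f j * indicator S ord0 j = \sum_(j in S) f j.
Proof.
rewrite [RHS]big_mkcond; apply: eq_bigr => j _.
by rewrite mxE; case: ifP; rewrite (mulr1, mulr0).
Qed.

(** Induction on the number of coordinates of x other than 0 and 1: such a
    coordinate x_j writes x as the barycentre, with weights x_j and 1 - x_j, of
    the two points of the cube obtained by rounding it to 1 and to 0. *)
Lemma concave_unit_cube_ge0 (h : 'rV[R]_n -> R) :
  (forall x y t, unit_cube x -> unit_cube y -> 0 <= t <= 1 ->
     t * h x + (1 - t) * h y <= h (t *: x + (1 - t) *: y)) ->
  (forall S, 0 <= h (indicator S)) ->
  forall x, unit_cube x -> 0 <= h x.
Proof.
move=> hconc hS x.
pose frac y := [set j : 'I_n | (y ord0 j != 0) && (y ord0 j != 1)].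
have [m] := ubnP #|frac x|; elim: m x => // m IH x.
rewrite ltnS => cardx x01; have [fx0|[j jx]] := set_0Vmem (frac x).
  suff -> : x = indicator [set j | x ord0 j == 1] by exact: hS.
  apply/rowP => j; rewrite mxE inE.
  have := finset.in_set0 j; rewrite -fx0 inE.
  by case: eqVneq => [->|_] /=; [rewrite eq_sym oner_eq0|case: eqVneq].
pose fix_j (v : R) := (\row_i if i == j then v else x ord0 i) : 'rV[R]_n.
have fix01 v : 0 <= v <= 1 -> unit_cube (fix_j v).
  by move=> v01 i; rewrite mxE; case: ifP.
have fix_ge0 v : v \in [:: 0; 1] -> 0 <= h (fix_j v).
  rewrite !inE => v01; apply: IH.
    apply: leq_trans cardx; apply: proper_card; apply/properP; split.
      apply/fintype.subsetP => i; rewrite !inE mxE; case: (i =P j) => // _.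
      by rewrite -negb_or v01.
    by exists j => //; rewrite !inE mxE eqxx -negb_or v01.
  by apply: fix01; case/orP: v01 => /eqP->; rewrite ?lexx ?ler01.
have -> : x = x ord0 j *: fix_j 1 + (1 - x ord0 j) *: fix_j 0.
  apply/rowP => i; rewrite !mxE; case: eqP => [->|_]; ring.
apply: le_trans (hconc _ _ _ _ _ (x01 j)); try by apply: fix01; rewrite lexx ler01.
have /andP[xj0 xj1] := x01 j.
by rewrite addr_ge0// mulr_ge0 ?subr_ge0// fix_ge0 ?inE ?eqxx ?orbT.
Qed.

End cube.

(** * Greedy vertices of the polyhedron of a set function *)

Section greedy.
Context {R : realType} {n : nat}.
Implicit Types (x y p q : 'rV[R]_n) (S A B : {set 'I_n}) (s : seq 'I_n).
Variable f : {set 'I_n} -> R.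

Definition polyhedron : set 'rV[R]_n :=
  [set p | forall S, \sum_(j in S) p ord0 j <= f S]%classic.

(** Items are listed in the order opposite to the one in which the greedy
    algorithm takes them, so that the chain of sets it builds consists of the
    suffixes of s and the last item taken is the head of s, which suits induction
    on s. *)
Definition tight_along p s :=
  forall k, \sum_(j in [set j in drop k s]) p ord0 j = f [set j in drop k s].

Lemma tight_along_cons p i s : tight_along p (i :: s) <->
  \sum_(j in [set j in i :: s]) p ord0 j = f [set j in i :: s] /\
  tight_along p s.
Proof.
split=> [ps|[pis ps] [|k]//]; last exact: ps.
by split=> [|k]; [exact: (ps 0)|exact: (ps k.+1)].
Qed.

Lemma sum_set_cons p i s : i \notin s ->
  \sum_(j in [set j in i :: s]) p ord0 j =
    p ord0 i + \sum_(j in [set j in s]) p ord0 j.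
Proof. by move=> si; rewrite finset.set_cons big_setU1// inE. Qed.

(** Consecutive sets of the chain differ by one item, whose coordinate is
    therefore the difference of two values of f. *)
Lemma tight_along_inj p q s : uniq s -> tight_along p s -> tight_along q s ->
  {in s, p ord0 =1 q ord0}.
Proof.
elim: s => // i s IH /= /andP[si us] /tight_along_cons[pis ps].
move=> /tight_along_cons[qis qs] j; rewrite inE => /predU1P[->|js]; last exact: IH.
apply: (addIr (\sum_(j in [set j in s]) p ord0 j)).
rewrite -sum_set_cons// pis -qis sum_set_cons//; congr (_ + _).
by have := ps 0; have := qs 0; rewrite drop0 => -> ->.
Qed.

(** A constraint tight at a proper convex combination of two points of the
    polyhedron is tight at both of them; so two points averaging to p satisfy the
    same tight constraints as p, which determine p. *)
Lemma tight_along_extreme p s : uniq s -> (forall j, j \in s) ->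
  polyhedron p -> tight_along p s -> extreme_points polyhedron p.
Proof.
move=> us sT pf ps; split=> // y w t yf wf /andP[t0 t1] pyw.
have tight S : \sum_(j in S) p ord0 j = f S ->
    \sum_(j in S) y ord0 j = f S /\ \sum_(j in S) w ord0 j = f S.
  have := yf S; have := wf S.
  have -> : \sum_(j in S) p ord0 j =
      t * \sum_(j in S) y ord0 j + (1 - t) * \sum_(j in S) w ord0 j.
    by rewrite !mulr_sumr -big_split; apply: eq_bigr => j _; rewrite pyw !mxE.
  by move=> *; split; nra.
by split; apply/rowP => j; apply: (@tight_along_inj _ _ s) => // k;
  have [] := tight _ (ps k).
Qed.

Section submodular.
Hypothesis f0 : f finset.set0 = 0.
(* Submodularity in the form of decreasing marginal values. *)
Hypothesis f_submodular : forall A B i, A \subset B -> i \notin B ->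
  f (i |: B) + f A <= f (i |: A) + f B.

(** The greedy algorithm gives to each new item i its marginal value on top of the
    set s of the items already taken. The marginal value of i on top of S :\ i,
    a subset of s, is at least as large, so the constraint of S follows from that
    of S :\ i. *)
Lemma greedy_point s : uniq s -> exists p,
  tight_along p s /\
  forall S, {subset S <= s} -> \sum_(j in S) p ord0 j <= f S.
Proof.
elim: s => [_|i s IH /= /andP[si us]].
  exists 0; split=> [k|S S0].
    by rewrite /= big1 => [|j _]; [rewrite finset.set_nil f0|rewrite mxE].
  rewrite (_ : S = finset.set0) ?f0 ?big_set0//.
  by apply/setP => j; rewrite inE; apply/negP => /S0.
have [p [ps pf]] := IH us.
pose q : 'rV[R]_n :=
  \row_j if j == i then f [set j in i :: s] - f [set j in s] else p ord0 j.
have qp S : i \notin S -> \sum_(j in S) q ord0 j = \sum_(j in S) p ord0 j.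
  move=> Si; apply: eq_bigr => j Sj; rewrite mxE ifN//.
  by apply: contraNneq Si => <-.
have qi : q ord0 i = f [set j in i :: s] - f [set j in s] by rewrite mxE eqxx.
have fs : \sum_(j in [set j in s]) p ord0 j = f [set j in s].
  by have := ps 0; rewrite drop0.
exists q; split.
  apply/tight_along_cons; split.
    by rewrite sum_set_cons// qp ?inE// fs qi subrK.
  move=> k; rewrite qp; first exact: ps.
  by rewrite inE; apply: contra si; exact: mem_drop.
move=> S Ss; have [Si|Si] := boolP (i \in S); last first.
  rewrite qp//; apply: pf => j Sj; have := Ss j Sj.
  by rewrite inE => /predU1P[ji|//]; move: Si; rewrite -ji Sj.
have Ds : {subset S :\ i <= s}.
  by move=> j; rewrite !inE => /andP[/negbTE ji /Ss]; rewrite inE ji.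
rewrite (big_setD1 i)//= qp ?finset.setD11// qi finset.set_cons.
have := pf _ Ds.
have := f_submodular (S :\ i) [set j in s] i; rewrite finset.setD1K// inE si.
have -> : S :\ i \subset [set j in s] by apply/fintype.subsetP => j /Ds; rewrite inE.
by move=> /(_ isT isT); lra.
Qed.

End submodular.

(** Peels off layers: subtracting from y its smallest entry m, attained at the head
    i of s, on the whole of s leaves a vector y' supported in the tail of s. By
    sublinearity the layer adds at most m f(s) to g, and it adds m p(s) to the
    right-hand side, which is the same number since s is tight. *)
Lemma sublinear_le_tight (g : 'rV[R]_n -> R) p s y :
  (forall u v, g (u + v) <= g u + g v) ->
  (forall (m : R) S, 0 <= m -> g (m *: indicator S) = m * f S) ->
  uniq s -> tight_along p s -> (forall j, 0 <= y ord0 j) ->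
  pairwise (fun i j => y ord0 i <= y ord0 j) s ->
  (forall j, j \notin s -> y ord0 j = 0) ->
  g y <= \sum_j p ord0 j * y ord0 j.
Proof.
move=> gD gf; elim: s y => [|i s IH] y.
  move=> _ _ y0 _ ys.
  have -> : y = 0 *: indicator finset.set0.
    by apply/rowP => j; rewrite mxE mul0r ys.
  by rewrite gf// mul0r big1// => j _; rewrite mxE mul0r mulr0.
move=> /= /andP[si us] /tight_along_cons[pis ps] y0 /andP[/seq.allP ymin ysort] ys.
set S := [set j in i :: s] in pis.
pose y' : 'rV[R]_n := y - y ord0 i *: indicator S.
have y'E j : y' ord0 j = y ord0 j - (if j \in i :: s then y ord0 i else 0).
  by rewrite !mxE inE; case: ifP; rewrite (mulr1, mulr0).
have yE : y = y ord0 i *: indicator S + y' by rewrite addrC subrK.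
have y's : g y' <= \sum_j p ord0 j * y' ord0 j.
  apply: IH => //.
  - move=> j; rewrite y'E inE; case: eqVneq => [->|_] /=; first by rewrite subrr.
    by case: ifP => [/ymin|]; rewrite (subr_ge0, subr0).
  - apply: (sub_in_pairwise (P := mem s)) ysort; last exact/seq.allP.
    by move=> j k js ks; rewrite !y'E !inE [j \in s]js [k \in s]ks !orbT lerD2r.
  - move=> j js; rewrite y'E inE (negbTE js) orbF.
    by case: eqVneq => [->|ji]; [rewrite subrr|rewrite subr0 ys// inE negb_or ji].
rewrite {1}yE (le_trans (gD _ _))// gf// -pis -sum_indicator mulr_sumr.
rewrite (le_trans (lerD (lexx _) y's))// -big_split/= le_eqVlt; apply/orP; left.
by apply/eqP/eq_bigr => j _; rewrite {2}yE !mxE; ring.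
Qed.

End greedy.

(** * Inclusions between the relaxations *)

Section relaxations.
Context {R : realType} {n : nat} (a sigma : 'I_n -> R) (b rho : R).
Hypothesis z_ge0 : 0 <= Phi_inv rho.
Implicit Types (x y p : 'rV[R]_n) (S A B : {set 'I_n}).

Definition weight_NC x := \sum_j a j * x ord0 j +
  Phi_inv rho * Num.sqrt (\sum_j sigma j ^+ 2 * x ord0 j).

Definition weight_C x := \sum_j a j * x ord0 j +
  Phi_inv rho * Num.sqrt (\sum_j sigma j ^+ 2 * x ord0 j ^+ 2).

Lemma sum_linear_comb (f : 'I_n -> R) x y (t u : R) :
  \sum_j f j * (t *: x + u *: y) ord0 j =
    t * \sum_j f j * x ord0 j + u * \sum_j f j * y ord0 j.
Proof.
by rewrite !mulr_sumr -big_split; apply: eq_bigr => j _; rewrite !mxE/=; ring.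
Qed.

(** Concavity of g reduces the inequality p.y <= g(y) on the cube to its vertices,
    where it is membership of p in Pi. *)
Lemma feasible_NC_P : (feasible_NC a sigma rho b `<=` feasible_P a sigma rho b)%classic.
Proof.
move=> x [x01 xb]; split=> // p [pPi _].
pose h y := weight_NC y - \sum_j p ord0 j * y ord0 j.
suff : 0 <= h x by rewrite subr_ge0 => /le_trans; exact.
have var_ge0 y : unit_cube y -> 0 <= \sum_j sigma j ^+ 2 * y ord0 j.
  move=> y01; apply: sumr_ge0 => j _; rewrite mulr_ge0 ?sqr_ge0//.
  by have /andP[] := y01 j.
apply: concave_unit_cube_ge0 x01 => [y w t y01 w01 t01|S].
  rewrite /h /weight_NC !sum_linear_comb.
  have := sqrt_concave _ _ _ (var_ge0 _ y01) (var_ge0 _ w01) t01.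
  by move=> /(ler_wpM2l z_ge0); lra.
by rewrite /h /weight_NC !sum_indicator subr_ge0; exact: pPi.
Qed.

Lemma F_submodular A B i : A \subset B -> i \notin B ->
  F a sigma rho (i |: B) + F a sigma rho A <=
    F a sigma rho (i |: A) + F a sigma rho B.
Proof.
move=> AB Bi; have Ai : i \notin A by apply: contra Bi; exact: (fintype.subsetP AB).
rewrite /F !big_setU1//=.
have AB_ge0 : 0 <= \sum_(j in A) sigma j ^+ 2 <= \sum_(j in B) sigma j ^+ 2.
  rewrite sumr_ge0 => [|j _]; last exact: sqr_ge0.
  rewrite [leRHS](big_setID A)/= (finset.setIidPr AB) lerDl sumr_ge0// => j _.
  exact: sqr_ge0.
have := sqrt_decreasing_increments _ _ _ AB_ge0 (sqr_ge0 (sigma i)).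
by move=> /(ler_wpM2l z_ge0); lra.
Qed.

Lemma weight_CD x y : weight_C (x + y) <= weight_C x + weight_C y.
Proof.
rewrite /weight_C.
have -> : \sum_j a j * (x + y) ord0 j =
    \sum_j a j * x ord0 j + \sum_j a j * y ord0 j.
  by rewrite -big_split; apply: eq_bigr => j _; rewrite mxE mulrDr.
have := minkowski_sum _ (index_enum 'I_n) (fun j => sigma j * x ord0 j)
  (fun j => sigma j * y ord0 j).
under eq_bigr do rewrite -mulrDr exprMn.
under [X in _ <= Num.sqrt X + _]eq_bigr do rewrite exprMn.
under [X in _ <= _ + Num.sqrt X]eq_bigr do rewrite exprMn.
under [X in _ -> _ + _ * Num.sqrt X <= _]eq_bigr do rewrite mxE.
by move=> /(ler_wpM2l z_ge0); lra.
Qed.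

Lemma weight_C_indicator (m : R) S : 0 <= m ->
  weight_C (m *: indicator S) = m * F a sigma rho S.
Proof.
move=> m0; rewrite /weight_C /F.
have -> : \sum_j a j * (m *: indicator S) ord0 j = m * \sum_(j in S) a j.
  rewrite -sum_indicator mulr_sumr; apply: eq_bigr => j _.
  by rewrite !mxE mulrCA.
have -> : \sum_j sigma j ^+ 2 * (m *: indicator S) ord0 j ^+ 2 =
    m ^+ 2 * \sum_(j in S) sigma j ^+ 2.
  rewrite -sum_indicator mulr_sumr; apply: eq_bigr => j _.
  by rewrite !mxE; case: (j \in S) => /=; rewrite ?mulr1n ?mulr0n; ring.
by rewrite sqrtrM ?sqr_ge0// sqrtr_sqr ger0_norm//; ring.
Qed.

(** The extreme point to test x against is the greedy one for the order in which x
    decreases. *)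
Lemma feasible_P_C : (feasible_P a sigma rho b `<=` feasible_C a sigma rho b)%classic.
Proof.
move=> x [x01 xb]; split=> //; rewrite -/(weight_C x).
pose le_x i j := x ord0 i <= x ord0 j.
pose s := sort le_x (enum 'I_n).
have us : uniq s by rewrite sort_uniq enum_uniq.
have sT j : j \in s by rewrite mem_sort mem_enum.
have s_sorted : pairwise le_x s.
  rewrite -sorted_pairwise; last by move=> j i k; exact: le_trans.
  by apply: sort_sorted => i j; exact: le_total.
have F0 : F a sigma rho finset.set0 = 0 by rewrite /F !big_set0 sqrtr0 mulr0 addr0.
have [p [ps pF]] := greedy_point _ F0 F_submodular s us.
apply: le_trans (xb p _).
  apply: (sublinear_le_tight (F a sigma rho) weight_C p s) => //.
  - exact: weight_CD.
  - exact: weight_C_indicator.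
  - by move=> j; have /andP[] := x01 j.
  - by move=> j; rewrite sT.
apply: (tight_along_extreme _ _ s) => // S.
by apply: pF => j _.
Qed.

End relaxations.

Theorem theorem1 (R : realType) (n : nat) (c a sigma : 'I_n -> R) (b rho : R)
  (hc : forall j, 0 < c j)
  (ha : forall j, 0 < a j)
  (hsigma : forall j, 0 <= sigma j)
  (hb : 0 < b)
  (hrho : 2^-1 <= rho < 1)
  (htotal : b < \sum_j a j + Phi_inv rho * Num.sqrt (\sum_j sigma j ^+ 2))
  (hitem : forall j, a j + Phi_inv rho * sigma j <= b) :
  z_NC c a sigma rho b <= z_P c a sigma rho b /\
  z_P c a sigma rho b <= z_C c a sigma rho b.
Proof.
have z0 := Phi_inv_ge0 _ hrho.
have [x xNC [<- _]] := z_NC_max c a sigma rho (ltW hb).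
have [y yP [<- ymax]] := z_P_max c a sigma rho (ltW hb).
have [w _ [<- wmax]] := z_C_max c a sigma rho (ltW hb).
by split; [apply/ymax/feasible_NC_P|apply/wmax/feasible_P_C].
Qed.
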